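(* Let $X$ and $Y$ be metric spaces, let $\mathcal{F}_1$ and $\mathcal{F}_2$ be two classes of maps between metric spaces, and suppose that $$d_H^{\mathcal{O}}\bigl(\mathcal{F}_1[X,Y],\,\mathcal{F}_2[X,Y]\bigr)=D .$$ Then $$\bigl|d_{GH}^{\mathcal{F}_1}(X,Y)-d_{GH}^{\mathcal{F}_2}(X,Y)\bigr|\le D .$$
   Context: Distances between points $x,y$ of a metric space are written $|xy|$, $|x,y|$ or $d(x,y)$. $\mathcal{O}$ denotes the class of all (arbitrary, not necessarily continuous) maps between metric spaces, and $\mathcal{O}(X,Y)$ the maps $X\to Y$. Each map carries its domain and codomain. Generalized pseudometric on $\mathcal{O}$: for $f_1,f_2\in\mathcal{O}(X,Y)$ set $d_{\mathcal{O}}(f_1,f_2)=\sup_{x\in X}d_Y(f_1(x),f_2(x))\in[0,\infty]$; maps acting between different (ordered) pairs of spaces are at distance $\infty$. For a class of maps $\mathcal{F}\subseteq\mathcal{O}$, $\mathcal{F}(X,Y)$ is the class of maps in $\mathcal{F}$ from $X$ to $Y$ and $\mathcal{F}[X,Y]=\mathcal{F}(X,Y)\cup\mathcal{F}(Y,X)$. The classes here need not be classes of morphisms of a category (no identities or closure under composition required). $d_H^{\mathcal{O}}$ is the Hausdorff distance with respect to $d_{\mathcal{O}}$ between non-empty subclasses of $\mathcal{O}$: $d_H^{\mathcal{O}}(A,B)=\inf\{r: A\subset U_r(B)\text{ and }B\subset U_r(A)\}\in[0,\infty]$, where $U_r(A)$ is the set of points at distance less than $r$ from some point of $A$ and $\inf\emptyset=\infty$.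 For $f:X\to Y$, $\operatorname{dis} f=\sup_{a,a'\in X}\bigl|d_X(a,a')-d_Y(f(a),f(a'))\bigr|$. For $f:X\to Y$, $g:Y\to X$, $\operatorname{codis}(f,g)=\sup_{x\in X,\,y\in Y}\bigl|d_X(x,g(y))-d_Y(f(x),y)\bigr|$. The $\mathcal{F}$-Gromov--Hausdorff distance is $$d_{GH}^{\mathcal{F}}(X,Y)=\tfrac12\inf_{f\in\mathcal{F}(X,Y),\ g\in\mathcal{F}(Y,X)}\max\{\operatorname{dis}f,\operatorname{dis}g,\operatorname{codis}(f,g)\}\in[0,\infty],$$ with the infimum over the empty set equal to $\infty$. Convention: for $a,b,D\in[0,\infty]$, the inequality $|a-b|\le D$ means $a\le b+D$ and $b\le a+D$. *)

(* Defs.v *)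
From HB Require Import structures.
From mathcomp Require Import all_boot all_order all_algebra.
From mathcomp Require Import all_classical all_reals all_analysis.

Set Implicit Arguments.
Unset Strict Implicit.
Unset Printing Implicit Defensive.

Import Order.TTheory GRing.Theory Num.Theory.

Local Open Scope classical_set_scope.
Local Open Scope ring_scope.
Local Open Scope ereal_scope.

(* Supremum in the lattice [0, +oo]: agrees with [ereal_sup] on nonempty sets of
   nonnegative values, but the supremum of the empty set is 0 (not -oo). *)
Definition sup_ge0 (R : realType) (A : set (\bar R)) : \bar R :=
  maxe 0 (ereal_sup A).

(* The class O of all maps between metric spaces; a map carries the ordered pair
   (domain, codomain) as its tag. *)
Definition omap (R : realType) : Type :=
  {XY : metricType R * metricType R & XY.1 -> XY.2}.

Definition to_omap (R : realType) (X Y : metricType R) (f : X -> Y) : omap R :=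
  existT (fun XY : metricType R * metricType R => XY.1 -> XY.2) (X, Y) f.

Definition unif_dist (R : realType) (X Y : metricType R) (f g : X -> Y)
    : \bar R :=
  sup_ge0 [set (mdist (f x) (g x))%:E | x in [set: X]].

Definition cast_map (R : realType) (P Q : metricType R * metricType R)
    (e : P = Q) (f : P.1 -> P.2) : Q.1 -> Q.2 :=
  eq_rect P (fun XY : metricType R * metricType R => XY.1 -> XY.2) f Q e.

Definition d_O (R : realType) (f g : omap R) : \bar R :=
  if pselect (projT1 g = projT1 f) is left e
  then unif_dist (projT2 f) (cast_map e (projT2 g))
  else +oo.

Lemma d_O_to_omap (R : realType) (X Y : metricType R) (f g : X -> Y) :
  d_O (to_omap f) (to_omap g) = unif_dist f g.
Proof.
rewrite /d_O; case: pselect => [e|//].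
by rewrite (Prop_irrelevance e erefl).
Qed.

(* [omap R] lives in a universe too large for MathComp-Analysis' [set], so classes
   of maps are plain predicates on [omap R]. *)
Definition map_class (R : realType) : Type := omap R -> Prop.

Definition neighborhood (R : realType) (T : Type) (d : T -> T -> \bar R)
    (r : R) (A : T -> Prop) : T -> Prop :=
  fun x => exists2 a, A a & d x a < r%:E.

(* Only radii r >= 0 are considered, so that the infimum lies in [0, +oo]; if no
   radius qualifies it is ereal_inf set0 = +oo. *)
Definition hausdorff_dist (R : realType) (T : Type) (d : T -> T -> \bar R)
    (A B : T -> Prop) : \bar R :=
  ereal_inf [set r%:E | r in [set r : R | (0 <= r)%R /\
    (forall x, A x -> neighborhood d r B x) /\
    (forall x, B x -> neighborhood d r A x)]].

(* F(X, Y) *)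
Definition maps_in (R : realType) (F : map_class R) (X Y : metricType R)
    : set (X -> Y) :=
  [set f | F (to_omap f)].
Arguments maps_in {R} F X Y.

(* F[X, Y] = F(X, Y) U F(Y, X) *)
Definition maps_between (R : realType) (F : map_class R) (X Y : metricType R)
    : map_class R :=
  fun h => (exists2 f : X -> Y, maps_in F X Y f & h = to_omap f) \/
           (exists2 g : Y -> X, maps_in F Y X g & h = to_omap g).

Definition dis (R : realType) (X Y : metricType R) (f : X -> Y) : \bar R :=
  sup_ge0 [set (`|mdist p.1 p.2 - mdist (f p.1) (f p.2)|%R)%:E
          | p in [set: X * X]].

Definition codis (R : realType) (X Y : metricType R) (f : X -> Y) (g : Y -> X)
    : \bar R :=
  sup_ge0 [set (`|mdist p.1 (g p.2) - mdist (f p.1) p.2|%R)%:E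
          | p in [set: X * Y]].

Definition d_GH (R : realType) (F : map_class R) (X Y : metricType R)
    : \bar R :=
  (2^-1)%:E * ereal_inf
    [set maxe (maxe (dis p.1) (dis p.2)) (codis p.1 p.2)
    | p in maps_in F X Y `*` maps_in F Y X].

(* |a - b| <= D for a, b, D in [0, +oo] *)
Definition edist_le (R : realType) (a b D : \bar R) : Prop :=
  a <= b + D /\ b <= a + D.

(* Main.v *)
Require Import Defs.
From mathcomp Require Import all_boot all_order all_algebra.
From mathcomp Require Import all_classical all_reals all_analysis.
From mathcomp Require Import lra.

(** Moving a point of a metric space by at most [r] changes its distance to any
    other point by at most [r], so moving both points changes their distance by
    at most [r + r].  Hence replacing [f] and [g] by maps uniformly [r]-close to
    them increases [dis f], [dis g] and [codis f g] by at most [r + r], and the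
    factor 1/2 in the Gromov-Hausdorff distance turns this into [r].

    If every map of [F1[X, Y]] has an [r]-close map in [F2[X, Y]], every
    competitor [(f, g)] for [F1] therefore yields one for [F2] that is worse by
    at most [r] ([d_GH_le_radius]): a map at finite distance has the same domain
    and codomain, so it may replace the original one
    ([neighborhood_maps_in]).  The infimum over all radii [r] that are admissible
    in the Hausdorff distance gives one of the two inequalities; the other
    follows by exchanging the classes. *)

Import Order.TTheory GRing.Theory Num.Theory.

Local Open Scope classical_set_scope.
Local Open Scope ring_scope.

Lemma mdist_quadrilateral (R : realType) (X : metricType R) (x x' y y' : X) :
  `|mdist x y - mdist x' y'| <= mdist x x' + mdist y y'.
Proof.
have h1 := metric_triangle x x' y; have h2 := metric_triangle x' y' y.
have h3 := metric_triangle x' x y'; have h4 := metric_triangle x y y'.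
rewrite (metric_sym x' x) (metric_sym y' y) in h2 h3.
by rewrite ler_norml; apply/andP; split; lra.
Qed.

Lemma sup_ge0_ge0 (R : realType) (A : set (\bar R)) : (0 <= sup_ge0 A)%E.
Proof. by rewrite /sup_ge0 le_max lexx. Qed.

Lemma sup_ge0_leD (R : realType) (T : Type) (F G : T -> R) (c : R) :
  0 <= c -> (forall x, F x <= G x + c) ->
  (sup_ge0 [set (F x)%:E | x in setT] <=
   sup_ge0 [set (G x)%:E | x in setT] + c%:E)%E.
Proof.
move=> c0 FG; rewrite {1}/sup_ge0 ge_max; apply/andP; split.
  by apply: adde_ge0; rewrite ?sup_ge0_ge0 ?lee_fin.
apply: ge_ereal_sup => _ [x _ <-].
apply: (@le_trans _ _ ((G x)%:E + c%:E)%E); first by rewrite -EFinD lee_fin.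
apply: leeD2r; rewrite /sup_ge0 le_max; apply/orP; right.
by apply: ereal_sup_ubound; exists x.
Qed.

Lemma unif_dist_lt (R : realType) (X Y : metricType R) (f g : X -> Y) (r : R) :
  (unif_dist f g < r%:E)%E -> forall x, mdist (f x) (g x) <= r.
Proof.
move=> fgr x; rewrite -lee_fin; apply/ltW; apply: le_lt_trans fgr.
rewrite /unif_dist /sup_ge0 le_max; apply/orP; right.
by apply: ereal_sup_ubound; exists x.
Qed.

(** Both endpoints of the distance in [Y] move, hence the constant [r + r]. *)
Lemma dis_perturb (R : realType) (X Y : metricType R) (f f' : X -> Y) (r : R) :
  0 <= r -> (forall x, mdist (f x) (f' x) <= r) ->
  (dis f' <= dis f + (r + r)%:E)%E.
Proof.
move=> r0 ff'; apply: sup_ge0_leD => [|[a b] /=]; first exact: addr_ge0.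
apply: le_trans (ler_distD (mdist (f a) (f b)) _ _) _; rewrite lerD2l.
by apply: le_trans (mdist_quadrilateral _ _ _ _ _ _) _; apply: lerD.
Qed.

(** The moved points lie in two different distances, each of which contributes
    one [r]. *)
Lemma codis_perturb (R : realType) (X Y : metricType R) (f f' : X -> Y)
    (g g' : Y -> X) (r : R) :
  0 <= r -> (forall x, mdist (f x) (f' x) <= r) ->
  (forall y, mdist (g y) (g' y) <= r) ->
  (codis f' g' <= codis f g + (r + r)%:E)%E.
Proof.
move=> r0 ff' gg'; apply: sup_ge0_leD => [|[x y] /=]; first exact: addr_ge0.
have := mdist_quadrilateral _ _ x x (g y) (g' y).
have := mdist_quadrilateral _ _ (f x) (f' x) y y.
rewrite !mdistxx !ler_norml => /andP[h1 h2] /andP[h3 h4].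
have fx := ff' x; have gy := gg' y.
have := ler_norm (mdist x (g y) - mdist (f x) y).
have := ler_norm (- (mdist x (g y) - mdist (f x) y)); rewrite normrN => n1 n2.
by apply/andP; split; lra.
Qed.

Lemma maps_between_sym (R : realType) (F : map_class R) (X Y : metricType R) h :
  maps_between F X Y h -> maps_between F Y X h.
Proof. by case; [right|left]. Qed.

(** Finite distance forces equal tags; a close map from [F(Y, X)] is possible
    only when [X = Y], where [F(Y, X)] and [F(X, Y)] coincide. *)
Lemma neighborhood_maps_in (R : realType) (F : map_class R) (X Y : metricType R)
    (r : R) (f : X -> Y) :
  neighborhood (@d_O R) r (maps_between F X Y) (to_omap f) ->
  exists2 f', maps_in F X Y f' & forall x, mdist (f x) (f' x) <= r.
Proof.
case=> _ [[f' Ff' ->]|[g Fg ->]].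
  by rewrite d_O_to_omap => /unif_dist_lt ff'; exists f'.
move=> fg; have e : (Y, X) = (X, Y).
  by move: fg; rewrite /d_O; case: pselect.
have {e} eYX : Y = X by case: e.
subst Y; move: fg; rewrite d_O_to_omap => /unif_dist_lt fg.
by exists g.
Qed.

Lemma d_GH_ge0 (R : realType) (F : map_class R) (X Y : metricType R) :
  (0 <= d_GH F X Y)%E.
Proof.
apply: mule_ge0; first by rewrite lee_fin.
apply: le_ereal_inf_tmp => _ [p _ <-].
by rewrite !le_max lexx.
Qed.

Lemma d_GH_le_radius (R : realType) (X Y : metricType R) (F1 F2 : map_class R)
    (r : R) :
  0 <= r ->
  (forall h, maps_between F1 X Y h ->
     neighborhood (@d_O R) r (maps_between F2 X Y) h) ->
  (d_GH F2 X Y <= d_GH F1 X Y + r%:E)%E.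
Proof.
move=> r0 F12; rewrite /d_GH.
set I2 := ereal_inf _; set I1 := ereal_inf _.
have -> : r%:E = ((2^-1)%:E * (r + r)%:E)%E :> \bar R.
  by rewrite -EFinM; congr EFin; lra.
rewrite -muleDr//; last by rewrite fin_num_adde_defl.
rewrite lee_pmul2l ?lte_fin ?invr_gt0//.
rewrite -leeBlDr//; apply: le_ereal_inf_tmp => _ [[f g] [Ff Fg] <-].
have [f' Ff' ff'] : exists2 f', maps_in F2 X Y f' &
    forall x, mdist (f x) (f' x) <= r.
  by apply/neighborhood_maps_in/F12; left; exists f.
have [g' Fg' gg'] : exists2 g', maps_in F2 Y X g' &
    forall y, mdist (g y) (g' y) <= r.
  apply: neighborhood_maps_in.
  have [|h /maps_between_sym Fh gh] := F12 (to_omap g); last by exists h.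
  by right; exists g.
rewrite leeBlDr//.
apply: (@le_trans _ _ (maxe (maxe (dis f') (dis g')) (codis f' g'))).
  by apply: ereal_inf_lbound; exists (f', g').
rewrite 2!ge_max -andbA /=; apply/and3P; split.
- apply: le_trans (dis_perturb _ _ _ _ _ _ r0 ff') _.
  by apply: leeD2r; rewrite 2!le_max lexx.
- apply: le_trans (dis_perturb _ _ _ _ _ _ r0 gg') _.
  by apply: leeD2r; rewrite 2!le_max lexx !orbT.
- apply: le_trans (codis_perturb _ _ _ _ _ _ _ _ r0 ff' gg') _.
  by apply: leeD2r; rewrite 2!le_max lexx !orbT.
Qed.

Lemma hausdorff_dist_ge0 (R : realType) (T : Type) (d : T -> T -> \bar R)
    (A B : T -> Prop) : (0 <= hausdorff_dist d A B)%E.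
Proof. by apply: le_ereal_inf_tmp => _ [r [r0 _] <-]; rewrite lee_fin. Qed.

Lemma hausdorff_dist_sym (R : realType) (T : Type) (d : T -> T -> \bar R)
    (A B : T -> Prop) : hausdorff_dist d A B = hausdorff_dist d B A.
Proof.
by congr ereal_inf; apply/seteqP; split => _ [r [r0 [AB BA]] <-]; exists r.
Qed.

Lemma d_GH_le_hausdorff (R : realType) (X Y : metricType R)
    (F1 F2 : map_class R) :
  (d_GH F2 X Y <= d_GH F1 X Y +
     hausdorff_dist (@d_O R) (maps_between F1 X Y) (maps_between F2 X Y))%E.
Proof.
(* A finite [d_GH F1 X Y] can be subtracted, which turns the claim into a lower
   bound for the infimum defining the Hausdorff distance. *)
have /gee0P[->|[a a0 aE]] := d_GH_ge0 _ F1 X Y.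
  rewrite addye ?leey// -ltNye.
  exact: lt_le_trans (hausdorff_dist_ge0 _ _ _ _ _).
rewrite aE -leeBlDl//; apply: le_ereal_inf_tmp => _ [r [r0 [F12 _]] <-].
by rewrite leeBlDl// -aE; exact: d_GH_le_radius.
Qed.

Theorem theorem3p9 (R : realType) (X Y : metricType R)
    (F1 F2 : map_class R) (D : \bar R)
    (hD : hausdorff_dist (@d_O R) (maps_between F1 X Y) (maps_between F2 X Y)
          = D) :
  edist_le (d_GH F1 X Y) (d_GH F2 X Y) D.
Proof.
rewrite -hD; split; last exact: d_GH_le_hausdorff.
by rewrite hausdorff_dist_sym; exact: d_GH_le_hausdorff.
Qed.
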